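(* Let $n$ be an even integer with $4\le n\le 28$. Then the number of possible pairs $\left(\sharp c_I^{-1}(1),\ \sharp c_I^{-1}(2)\right)$, where $\mathcal{Q}$ is a smooth plane quartic with bitangents $L_1,\dots,L_{28}$ and $I\subset\{1,\dots,28\}$ is a subset with $\sharp I=n$, is less than or equal to $$\frac12\binom{n}{3}+1 .$$
   Context: Everything is over $\mathbb{C}$. For a smooth plane quartic $\mathcal{Q}\subset\mathbb{P}^2$, let $L_1,\dots,L_{28}$ denote its $28$ bitangent lines (lines meeting $\mathcal{Q}$ with even multiplicity at every intersection point), and let $f_{\mathcal{Q}}:S_{\mathcal{Q}}\to\mathbb{P}^2$ be the double cover branched along $\mathcal{Q}$. Connected number: for a plane curve $C$ none of whose irreducible components is contained in $\mathcal{Q}$ and such that $C\setminus\mathcal{Q}$ is connected, $c_{f_{\mathcal{Q}}}(C)$ denotes the number of connected components of $f_{\mathcal{Q}}^{-1}(C\setminus\mathcal{Q})$; it is $1$ or $2$. For $I\subset\{1,\dots,28\}$ put $\mathcal{L}_I=\sum_{i\in I}L_i$ and $$\underline{\mathrm{Sub}}_{\triangle}(\mathcal{Q},\mathcal{L}_I)=\Big\{\mathcal{Q}+\sum_{k=1}^3L_{i_k}\ \Big|\ \{i_1,i_2,i_3\}\subset I\Big\},$$ where $\{i_1,i_2,i_3\}$ runs over the $3$-element subsets of $I$. The map $c_I:\underline{\mathrm{Sub}}_{\triangle}(\mathcal{Q},\mathcal{L}_I)\to\{1,2\}$ is defined by $c_I\big(\mathcal{Q}+\sum_{k=1}^3L_{i_k}\big)=c_{f_{\mathcal{Q}}}\big(\sum_{k=1}^3L_{i_k}\big)$.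 *)

(* Defs.v *)
From HB Require Import structures.
From mathcomp Require Import all_boot all_order all_algebra.
From mathcomp Require Import finmap.
From mathcomp Require Import all_classical all_reals all_analysis.
From mathcomp Require Import complex.
From mathcomp Require Import -(notations) mpoly.

Set Implicit Arguments.
Unset Strict Implicit.
Unset Printing Implicit Defensive.

Import Order.TTheory GRing.Theory Num.Theory.
Import numFieldNormedType.Exports.

Local Open Scope classical_set_scope.
Local Open Scope ring_scope.
Local Open Scope quotient_scope.

(* Stated through a numClosedFieldType so that the Euclidean topology of the
   complex numbers (given by the modulus) is found by inference. *)
Definition C (R : realType) : numClosedFieldType := R[i].

Section PlaneQuartics.
Variable R : realType.
Local Notation K := (C R).
Local Notation form := (mpoly 3 K).

Definition eval (F : form) (v : 'rV[K]_3) : K := meval (v 0) F.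

(* The complex projective plane, with the quotient topology of C^3 \ {0}. *)
Definition affine3 : set 'rV[K]_3 := [set v | v != 0].

Definition proportional (u v : affine3) : bool :=
  `[< exists2 t : K, t != 0 & set_val v = t *: set_val u >].

Lemma proportional_equiv : equiv_class_of proportional.
Proof.
split=> [u|u v|v u w].
- by apply/asboolP; exists 1; rewrite ?oner_neq0// scale1r.
- apply/asboolP/asboolP => -[t t0 ->]; exists t^-1; rewrite ?invr_neq0//;
    by rewrite scalerA mulVf// scale1r.
- move=> /asboolP[s s0 e1] /asboolP[t t0 e2]; apply/asboolP.
  by exists (t * s); rewrite ?mulf_neq0// e2 e1 scalerA.
Qed.

Canonical proportional_equiv_rel := EquivRelPack proportional_equiv.

Definition P2 := quotient_topology {eq_quot proportional}.

Definition coords (P : P2) : 'rV[K]_3 := set_val (repr P).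

(* For homogeneous F the condition does not depend on the representative. *)
Definition curve (F : form) : set P2 := [set P | eval F (coords P) = 0].

Definition line (l : 'rV[K]_3) : set P2 := [set P | coords P *m l^T = 0].

Definition smooth_quartic (F : form) : Prop :=
  F \is ishomog1 4 mdeg /\
  (forall v : 'rV[K]_3, v != 0 -> eval F v = 0 ->
     exists i : 'I_3, eval (mderiv i F) v != 0).

(* F(p + X q): the restriction of F to the affine chart, centred at [p], of the
   line through [p] and [q].  Its order of vanishing at 0 is the intersection
   multiplicity of that line with F = 0 at [p]. *)
Definition restrict (F : form) (p q : 'rV[K]_3) : {poly K} :=
  mmap polyC (fun i => (p 0 i)%:P + (q 0 i) *: 'X) F.

Definition intersection_mult (F : form) (p q : 'rV[K]_3) : nat :=
  mup 0 (restrict F p q).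

(* The clause restrict F p q != 0 says that the line is not contained in the
   curve, so that the multiplicity is finite (mup is a junk value at 0). *)
Definition bitangents (F : form) : set (set P2) :=
  [set X | exists2 l : 'rV[K]_3, l != 0 & X = line l /\
     forall p q : 'rV[K]_3, row_free (col_mx p q) ->
       p *m l^T = 0 -> q *m l^T = 0 ->
       restrict F p q != 0 /\
       (eval F p = 0 -> ~~ odd (intersection_mult F p q))].

(* The total space of the line bundle O(2) on the projective plane: the
   quotient of {(v, w) | v != 0} by (v, w) ~ (t v, t^2 w). *)
Definition affine4 : set ('rV[K]_3 * K)%type := [set p | p.1 != 0].

Definition weighted_proportional (x y : affine4) : bool :=
  `[< exists2 t : K, t != 0 &
      set_val y = (t *: (set_val x).1, t ^+ 2 * (set_val x).2) >].

Lemma weighted_proportional_equiv : equiv_class_of weighted_proportional.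
Proof.
have sym x y : weighted_proportional x y -> weighted_proportional y x.
  move=> /asboolP[t t0 e]; apply/asboolP; exists t^-1; rewrite ?invr_neq0//.
  rewrite e /= scalerA mulVf// scale1r mulrA -exprMn mulVf// expr1n mul1r.
  by case: (set_val x).
split=> [x|x y|y x z].
- apply/asboolP; exists 1; rewrite ?oner_neq0// scale1r expr1n mul1r.
  by case: (set_val x).
- by apply/idP/idP; exact: sym.
- move=> /asboolP[s s0 e1] /asboolP[t t0 e2]; apply/asboolP.
  by exists (t * s); rewrite ?mulf_neq0// e2 e1 /= scalerA exprMn mulrA.
Qed.

Canonical weighted_proportional_equiv_rel :=
  EquivRelPack weighted_proportional_equiv.

Definition O2 := quotient_topology {eq_quot weighted_proportional}.

Definition fst_affine (x : affine4) : affine3 :=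
  exist _ (set_val x).1 (mem_set (set_valP x : affine3 (set_val x).1)).

Definition O2_proj (y : O2) : P2 := \pi_P2 (fst_affine (repr y)).

(* The double cover branched along F = 0 is the surface w^2 = F(v) in O(2),
   with the restriction of O2_proj as covering map. *)
Definition double_cover (F : form) : set O2 :=
  [set y | (set_val (repr y)).2 ^+ 2 = eval F (set_val (repr y)).1].

Definition components (T : topologicalType) (A : set T) : set (set T) :=
  [set connected_component A x | x in A].

Definition connected_number (F : form) (X : set P2) : nat :=
  #|` fset_set (components
        (double_cover F `&` O2_proj @^-1` (X `\` curve F)))|.

Definition sum_lines (L : 'I_28 -> set P2) (J : {set 'I_28}) : set P2 :=
  \bigcup_(i in [set` J]) L i.

(* The fibre over k of the map c_I.  All the curves involved are reduced, so
   the sums of curves are identified with their supports. *)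
Definition c_fiber (F : form) (L : 'I_28 -> set P2) (I : {set 'I_28}) (k : nat)
    : set (set P2) :=
  [set curve F `|` sum_lines L J | J in
     [set J : {set 'I_28} | [/\ J \subset I, #|J| = 3 &
                             connected_number F (sum_lines L J) = k]]].

Definition possible_pairs (n : nat) : set (nat * nat) :=
  [set ab | exists (F : form) (L : 'I_28 -> set P2) (I : {set 'I_28}),
     [/\ smooth_quartic F, set_bij setT (bitangents F) L, #|I| = n &
         ab = (#|` fset_set (c_fiber F L I 1)|, #|` fset_set (c_fiber F L I 2)|)]].

End PlaneQuartics.

(* Main.v *)
(* On the plane W in C^3 over a bitangent, the quartic form F has only roots of
   even order, so F = g^2 on W for a quadratic form g, and the part of the double
   cover w^2 = F over the bitangent off the quartic is the union of the two
   connected sheets w = g and w = -g.  Two bitangents meet off the quartic, where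
   g_i = +g_j or g_i = -g_j; this sign tells how their sheets are glued.  Hence
   three bitangents have connected number 1 exactly when an odd number of the
   three signs is -1.  The number of such triples in I is congruent modulo 2 to
   the number of negative pairs times n - 2, hence even, and it determines the
   number of the other triples. *)
Require Import Defs.
From mathcomp Require Import all_boot all_order all_algebra.
From mathcomp Require Import finmap.
From mathcomp Require Import all_classical all_reals all_analysis.
From mathcomp Require Import complex ring.
From mathcomp Require Import -(notations) mpoly.
Import Defs.

Set Implicit Arguments.
Unset Strict Implicit.
Unset Printing Implicit Defensive.

Import Order.TTheory GRing.Theory Num.Theory.
Import numFieldNormedType.Exports.

Local Open Scope ring_scope.

Lemma ord3P (i : 'I_3) : [\/ i = 0, i = 1 | i = 2].
Proof.
by case: i => -[|[|[|//]]] lt3; [constructor 1|constructor 2|constructor 3];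
  apply: val_inj.
Qed.

Lemma big_ord3 (T : Type) (idx : T) (op : Monoid.law idx) (f : 'I_3 -> T) :
  \big[op/idx]_i f i = op (op (f 0) (f 1)) (f 2).
Proof.
rewrite !big_ord_recl big_ord0 Monoid.mulm1 Monoid.mulmA.
by congr (op (op (f _) (f _)) (f _)); apply: val_inj.
Qed.

(** * Parity of triples *)

Section Parity.
Variables (N : nat) (s : rel 'I_N).
Hypothesis s_sym : forall i j, s i j = s j i.
Implicit Types I J : {set 'I_N}.

Definition pair_count J : nat := \sum_(i in J) \sum_(j in J | (i < j)%N) s i j.

(** The enumeration [f] of a triple need not be increasing; the symmetry of [s] makes the result
    independent of the order. *)
Lemma pair_count_image (f : 'I_3 -> 'I_N) : injective f ->
  pair_count (f @: [set: 'I_3]%SET) =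
  (s (f 0%R) (f 1%R) + s (f 1%R) (f 2%R) + s (f 0%R) (f 2%R))%N.
Proof.
move=> injf.
have -> : pair_count (f @: [set: 'I_3]%SET) =
    (\sum_(i < 3) \sum_(j < 3 | f i < f j) s (f i) (f j))%N.
  rewrite /pair_count big_imset /=; last by move=> ? ? _ _; exact: injf.
  apply: eq_big => [i|i _]; first by rewrite inE.
  rewrite big_mkcondr big_imset /=; last by move=> ? ? _ _; exact: injf.
  by rewrite [RHS]big_mkcond; apply: eq_bigl => j; rewrite inE.
have lt x y : x != y -> (f x < f y)%N = ~~ (f y < f x)%N.
  by case: ltngtP => // /ord_inj/injf ->; rewrite eqxx.
rewrite big_ord3 /= !(big_mkcond (fun j => (_ < f j)%N)) !big_ord3 /=.
rewrite !ltnn (lt 0 1) // (lt 1 2) // (lt 0 2) //.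
rewrite (s_sym (f 1) (f 0)) (s_sym (f 2) (f 1)) (s_sym (f 2) (f 0)).
move: (nat_of_bool (s (f 0) (f 1))) (nat_of_bool (s (f 1) (f 2))).
move: (nat_of_bool (s (f 0) (f 2))) => a b c.
(* Two of the eight cases are impossible orderings; the identity holds in them as well. *)
case: (f 1%R < f 0%R)%N; case: (f 2%R < f 1%R)%N; case: (f 2%R < f 0%R)%N => /=; ring.
Qed.

(** A triple containing [i] and [j] is determined by its third element, which runs over [I] without
    these two. *)
Lemma card_triples_through I i j : i \in I -> j \in I -> i != j ->
  #|[set J : {set 'I_N} | [&& J \subset I, #|J| == 3, i \in J & j \in J]]| =
  (#|I| - 2)%N.
Proof.
move=> iI jI ij.
have -> : (#|I| - 2)%N = #|I :\: [set i; j]|.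
  rewrite cardsD (finset.setIidPr _) ?cards2 ?ij //.
  by apply/fintype.subsetP => x; rewrite !inE => /orP[] /eqP ->.
rewrite -(card_in_imset (f := fun x => x |: [set i; j])).
  apply: eq_card => J; rewrite inE; apply/idP/imsetP.
    move=> /and4P[JI J3 iJ jJ].
    have sJ : [set i; j] \subset J.
      by apply/fintype.subsetP => x; rewrite !inE => /orP[] /eqP ->.
    have : #|J :\: [set i; j]| == 1%N.
      by rewrite cardsD (finset.setIidPr sJ) cards2 ij (eqP J3).
    move=> /cards1P[x xE]; exists x.
      have : x \in J :\: [set i; j] by rewrite xE inE.
      by rewrite !inE => /andP[-> /(fintype.subsetP JI)].
    by rewrite -xE finset.setUC -{1}(finset.setIidPr sJ) finset.setID.
  move=> [x]; rewrite !inE => /andP[xij xI] ->.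
  rewrite cardsU1 !inE xij cards2 ij !eqxx !orbT /= andbT.
  by apply/fintype.subsetP => y; rewrite !inE => /orP[/eqP ->|/orP[] /eqP ->].
move=> x y; rewrite !inE => /andP[xij _] /andP[yij _] /finset.setP/(_ x).
by rewrite !inE eqxx (negPf xij) !orbF => /esym/eqP.
Qed.

(* Modulo 2, count the triples with an odd number of s-pairs by pairs: each pair
   lies in #|I| - 2 triples. *)
Lemma even_odd_triples I : ~~ odd #|I| ->
  ~~ odd #|[set J : {set 'I_N} | [&& J \subset I, #|J| == 3 & odd (pair_count J)]]|.
Proof.
move=> evI; have oddS := big_morph odd oddD (erefl : odd 0 = false).
rewrite -sum1_card.
rewrite (eq_bigl (fun J => (J \subset I) && (#|J| == 3) && odd (pair_count J)));
  last by move=> J; rewrite inE andbA.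
rewrite big_mkcondr oddS.
rewrite (eq_bigr (fun J => odd (pair_count J)));
  last by move=> J _; case: (odd (pair_count J)).
rewrite -oddS /pair_count.
rewrite (exchange_big_dep (mem I)) /=; last first.
  by move=> J i /andP[/fintype.subsetP JI _]; exact: JI.
rewrite oddS big1 // => i iI.
rewrite (exchange_big_dep (fun j => (j \in I) && (i < j)%N)) /=; last first.
  by move=> J j /andP[/andP[/fintype.subsetP JI _] _] /andP[/JI -> ->].
rewrite oddS big1 // => j /andP[jI ij].
rewrite (eq_bigl [in [set J : {set 'I_N} |
    [&& J \subset I, #|J| == 3, i \in J & j \in J]]]);
  last by move=> J; rewrite !inE ij andbT -!andbA.
have ij' : i != j by apply: contraTneq ij => ->; rewrite ltnn.
have I2 : (2 <= #|I|)%N.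
  rewrite (_ : 2%N = #|[set i; j]|); last by rewrite cards2 ij'.
  by apply/subset_leq_card/fintype.subsetP => x; rewrite !inE => /orP[] /eqP ->.
by rewrite sum_nat_const card_triples_through // oddM oddB // (negPf evI).
Qed.

End Parity.

Local Open Scope classical_set_scope.
Local Open Scope ring_scope.

(** * Forms restricted to lines *)

(** Induction on the size: a root has multiplicity at least 2, so a factor [('X - a%:P) ^+ 2] splits
    off and leaves all parities unchanged; constants are squares because the field is algebraically
    closed. *)
Lemma even_mup_square (F : numClosedFieldType) (h : {poly F}) :
  h != 0 -> (forall a, ~~ odd (mup a h)) -> exists g, h = g ^+ 2.
Proof.
have [n] := ubnP (size h); elim: n h => // n IHn h /ltnSE lt_h h0 evh.
have [/size1_polyC ->|sz_h] := leqP (size h) 1.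
  by exists (sqrtC h`_0)%:P; rewrite -rmorphXn /= sqrtCK.
have [a ra] : exists a, root h a.
  by apply: closed_rootP; rewrite neq_ltn sz_h orbT.
have : (1 < mup a h)%N.
  have : (0 < mup a h)%N by rewrite -XsubC_dvd // dvdp_XsubCl.
  by have := evh a; case: (mup a h) => [|[]].
rewrite mup_geq // => /dvdpP [k hE].
have k0 : k != 0 by apply: contraNneq h0 => k0; rewrite hE k0 mul0r.
have X0 : ('X - a%:P) ^+ 2 != 0 :> {poly F} by rewrite expf_neq0 ?polyXsubC_eq0.
have [g kE] : exists g, k = g ^+ 2.
  apply: IHn => //.
    rewrite (leq_trans _ lt_h) // hE size_Mmonic ?monic_exp ?monicXsubC //.
    by rewrite size_exp_XsubC addn3.
  move=> b; have := evh b; rewrite hE mupM // mup_XsubCX oddD.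
  by case: ifP => _; rewrite addbF.
by exists (g * ('X - a%:P)); rewrite exprMn -kE.
Qed.

(** The shape matches a monomial restricted to a line and its three partial derivatives; where an
    exponent is 0, the factor [0%:R] makes the truncated [.-1] harmless. *)
Lemma deriv_prod3 (S : comNzRingType) (f g h : {poly S}) (a b c : nat) :
  (f ^+ a * g ^+ b * h ^+ c)^`() =
    f^`() * (a%:R%:P * (f ^+ a.-1 * g ^+ b * h ^+ c)) +
    g^`() * (b%:R%:P * (f ^+ a * g ^+ b.-1 * h ^+ c)) +
    h^`() * (c%:R%:P * (f ^+ a * g ^+ b * h ^+ c.-1)).
Proof.
rewrite derivM derivM (deriv_exp f) (deriv_exp g) (deriv_exp h).
rewrite !polyC_natr.
rewrite -(mulr_natr _ a) -(mulr_natr _ b) -(mulr_natr _ c).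
ring.
Qed.

Section Restriction.
Variable R : realType.
Local Notation K := (C R).
Implicit Types (F : mpoly 3 K) (p q v l : 'rV[K]_3).

Lemma horner_restrict F p q a : (restrict F p q).[a] = eval F (p + a *: q).
Proof.
rewrite /restrict /eval mevalE /mmap horner_sum; apply: eq_bigr => m _.
rewrite hornerM hornerC /mmap1 horner_prod; congr (_ * _).
apply: eq_bigr => i _; rewrite horner_exp !hornerE !mxE; congr (_ ^+ _); ring.
Qed.

(** Moving the base point along the line turns a root at [a] into a root at 0, where
    [intersection_mult] is measured. *)
Lemma restrict_shift F p q a :
  restrict F (p + a *: q) q = restrict F p q \Po ('X + a%:P).
Proof.
rewrite /restrict /mmap raddf_sum; apply: eq_bigr => m _ /=.
rewrite rmorphM /= comp_polyC /mmap1 rmorph_prod; congr (_ * _).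
apply: eq_bigr => i _; rewrite rmorphXn /=; congr (_ ^+ _).
rewrite comp_polyD comp_polyC comp_polyZ comp_polyX !mxE -!mul_polyC.
rewrite !rmorphD !rmorphM /=.
ring.
Qed.

Lemma size_restrict F d p q :
  F \is ishomog1 d mdeg -> (size (restrict F p q) <= d.+1)%N.
Proof.
move=> /dhomogP homF; rewrite /restrict /mmap big_seq.
apply: (big_ind (fun f : {poly K} => size f <= d.+1)%N).
- by rewrite size_poly0.
- by move=> f g hf hg; rewrite (leq_trans (size_polyD _ _)) // geq_max hf.
move=> m /homF; rewrite /= mdegE => mE.
rewrite mul_polyC (leq_trans (size_scale_leq _ _)) // -mE /mmap1.
have sizeM (f g : {poly K}) a b : (size f <= a.+1 -> size g <= b.+1 ->
    size (f * g)%R <= (a + b).+1)%N.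
  move=> hf hg; rewrite (leq_trans (size_polyMleq _ _)) //.
  by rewrite -subn1 leq_subLR add1n (leq_trans (leq_add hf hg)) // addSn addnS.
apply: (big_rec2 (fun (f : {poly K}) a => size f <= a.+1)%N) => [|i f a _ hf].
  by rewrite size_poly1.
apply: (sizeM _ _ (m i) a) => //; elim: (m i) => [|k IHk].
  by rewrite expr0 size_poly1.
rewrite exprS; apply: (sizeM _ _ 1%N k) => //.
rewrite (leq_trans (size_polyD _ _)) // geq_max.
rewrite (leq_trans (size_polyC_leq1 _)) // (leq_trans (size_scale_leq _ _)) //.
by rewrite size_polyX.
Qed.

Lemma evalZ F d t v :
  F \is ishomog1 d mdeg -> eval F (t *: v) = t ^+ d * eval F v.
Proof.
move=> /dhomogP homF; rewrite /eval !mevalE big_distrr /= !big_seq.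
apply: eq_bigr => m /homF /= <-; rewrite mulrCA; congr (_ * _).
rewrite mdegE -prodrXr -big_split; apply: eq_bigr => i _ /=.
by rewrite mxE exprMn.
Qed.

(** Chain rule: both sides are linear in [F], so monomials suffice. *)
Lemma deriv_restrict F p q :
  (restrict F p q)^`() = \sum_i q 0 i *: restrict (mderiv i F) p q.
Proof.
elim/mpolyind: F => [|c m F _ _ IH].
  rewrite /restrict mmap0 deriv0 big1 // => i _.
  by rewrite mderiv0 mmap0 scaler0.
rewrite /restrict mmapD mmapZ derivD mul_polyC derivZ mmapX -/(restrict F p q).
rewrite IH.
under [RHS]eq_bigr => i _ do
  rewrite mderivD mderivZ mderivX mmapD !mmapZ mmapX scalerDr -/(restrict _ p q).
rewrite big_split /=; congr (_ + _).
rewrite big_ord3 /mmap1 !big_ord3 /= !mnmBE !mnm1E /= !subn0 !subn1.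
have dh i : ((p 0 i)%:P + q 0 i *: 'X)^`() = (q 0 i)%:P.
  by rewrite derivD derivC derivZ derivX add0r alg_polyC.
rewrite deriv_prod3 !dh -!mul_polyC.
move: (_ * _ ^+ _) => A; move: (_ * _ ^+ _) => B; move: (_ * _ ^+ _) => D.
by rewrite !mulrDr !(mulrCA c%:P).
Qed.

End Restriction.

(** * Bitangents *)

Section Planes.
Variable K : fieldType.
Implicit Types (l p q v : 'rV[K]_3).

Lemma plane_basis l : l != 0 ->
  exists p q, [/\ row_free (col_mx p q), p *m l^T = 0, q *m l^T = 0 &
    forall v, v *m l^T = 0 -> exists s t, v = s *: p + t *: q].
Proof.
move=> l0; have rk : \rank (kermx l^T) = 2.
  by rewrite mxrank_ker mxrank_tr rank_rV l0.
(* The rank is written [1 + 1] so that the basis splits into two rows. *)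
have : exists B : 'M[K]_(1 + 1, 3), row_free B /\ (B :=: kermx l^T)%MS.
  move: (row_base (kermx l^T)) (row_base_free (kermx l^T)) (eq_row_base (kermx l^T)).
  by rewrite rk => B fB eB; exists B.
case=> B [fB eB]; exists (usubmx B), (dsubmx B); rewrite vsubmxK.
have [pl ql] : usubmx B *m l^T = 0 /\ dsubmx B *m l^T = 0.
  have : B *m l^T = 0 by apply/sub_kermxP; rewrite eB.
  by rewrite -{1}(vsubmxK B) mul_col_mx -(col_mx0 _ 1 1) => /eq_col_mx.
split=> // v /sub_kermxP; rewrite -eB => /submxP[u ->].
exists (lsubmx u 0 0), (rsubmx u 0 0).
rewrite -{1}(hsubmxK u) -{1}(vsubmxK B) mul_row_col.
by rewrite {1}(mx11_scalar (lsubmx u)) {1}(mx11_scalar (rsubmx u)) !mul_scalar_mx.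
Qed.

Lemma plane_meet l l' : row_free (col_mx l l') ->
  exists2 p, p != 0 & [/\ p *m l^T = 0, p *m l'^T = 0 &
    forall v, v *m l^T = 0 -> v *m l'^T = 0 -> exists t, v = t *: p].
Proof.
move=> /eqP rk; have rk1 : \rank (kermx (col_mx l l')^T) = 1.
  by rewrite mxrank_ker mxrank_tr rk.
have memE v :
    (v <= kermx (col_mx l l')^T)%MS = (v *m l^T == 0) && (v *m l'^T == 0).
  by rewrite sub_kermx tr_col_mx mul_mx_row row_mx_eq0.
have p0 : nz_row (kermx (col_mx l l')^T) != 0.
  by rewrite nz_row_eq0 -mxrank_eq0 rk1.
exists (nz_row (kermx (col_mx l l')^T)) => //.
have := nz_row_sub (kermx (col_mx l l')^T); rewrite memE.
move=> /andP[/eqP pl /eqP pl'].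
split=> // v /eqP vl /eqP vl'.
have : (v <= kermx (col_mx l l')^T)%MS by rewrite memE vl.
have /eqmxP/eqmx_sym : (nz_row (kermx (col_mx l l')^T) == kermx (col_mx l l')^T)%MS.
  by rewrite -mxrank_leqif_eq ?nz_row_sub // rk1 rank_rV p0.
by move=> ->; move/sub_rVP.
Qed.

Lemma row_free_pair p q :
  p != 0 -> (forall t, q != t *: p) -> row_free (col_mx p q).
Proof.
move=> p0 qp; apply: (@inj_row_free _ (1 + 1)) => u.
rewrite -(hsubmxK u) mul_row_col.
rewrite {1}(mx11_scalar (lsubmx u)) {1}(mx11_scalar (rsubmx u)) !mul_scalar_mx.
move=> e; have b0 : rsubmx u 0 0 = 0.
  apply: contraTeq (qp (- (rsubmx u 0 0)^-1 * lsubmx u 0 0)) => b0.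
  rewrite negbK -(inj_eq (scalerI b0)) scalerA mulrA mulrN divff //.
  by rewrite mulN1r scaleNr -addr_eq0 addrC e.
have a0 : lsubmx u 0 0 = 0.
  by move: e => /eqP; rewrite b0 scale0r addr0 scaler_eq0 (negPf p0) orbF => /eqP.
rewrite (mx11_scalar (lsubmx u)) (mx11_scalar (rsubmx u)) a0 b0.
by rewrite !raddf0 row_mx0.
Qed.

Lemma row_free_noncollinear p q v s t : row_free (col_mx p q) ->
  p = s *: v -> q = t *: v -> False.
Proof.
move=> /eqP + pE qE; rewrite pE qE => rk.
have : (\rank (col_mx (s *: v) (t *: v)) <= \rank v)%N.
  by apply/mxrankS; rewrite col_mx_sub !scalemx_sub.
by rewrite rk => /leq_trans/(_ (rank_leq_row _)).
Qed.

Lemma row_freeD p q t : row_free (col_mx p q) -> row_free (col_mx (p + t *: q) q).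
Proof.
move=> f; apply: (@inj_row_free _ (1 + 1)) => u.
rewrite -(hsubmxK u) mul_row_col => e.
have : row_mx (lsubmx u) (t *: lsubmx u + rsubmx u) *m col_mx p q = 0.
  by rewrite mul_row_col mulmxDl -scalemxAl addrA scalemxAr -mulmxDr.
rewrite -(mul0mx _ (col_mx p q)) => /(row_free_inj f); rewrite -row_mx0.
by move=> /eq_row_mx[-> ]; rewrite scaler0 add0r => ->.
Qed.

(** Were [l'] zero on a basis of the plane of [l], both basis vectors would lie in the
    one-dimensional intersection of the two planes. Rescaling a nonzero value gives 1. *)
Lemma plane_sep l l' : row_free (col_mx l l') ->
  exists2 w : 'rV_3, w *m l^T = 0 & w *m l'^T = 1%:M.
Proof.
move=> f; have l0 : l != 0.
  apply/eqP => l0; apply: (@row_free_noncollinear l l' l' 0 1 f).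
    by rewrite scale0r.
  by rewrite scale1r.
have [p [q [fpq pl ql _]]] := plane_basis l0.
suff [w wl wl'] : exists2 w : 'rV_3, w *m l^T = 0 & w *m l'^T != 0.
  exists (((w *m l'^T) 0 0)^-1 *: w); first by rewrite -scalemxAl wl scaler0.
  rewrite -scalemxAl {2}(mx11_scalar (w *m l'^T)) -mul_scalar_mx -scalar_mxM.
  rewrite mulVf //; apply: contraNneq wl' => w0.
  by rewrite (mx11_scalar (w *m l'^T)) w0 raddf0.
have [x x0 [xl xl' xE]] := plane_meet f.
have [pl'|] := eqVneq (p *m l'^T) 0; last by exists p.
have [ql'|] := eqVneq (q *m l'^T) 0; last by exists q.
have [s pE] := xE _ pl pl'; have [t qE] := xE _ ql ql'.
by case: (row_free_noncollinear fpq pE qE).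
Qed.

End Planes.

(** * Quartic forms along a bitangent *)

Section Bitangent.
Variable R : realType.
Local Notation K := (C R).
Implicit Types (F : mpoly 3 K) (l p q v : 'rV[K]_3).

Lemma mup_comp_shift (k : fieldType) (h : {poly k}) a :
  h != 0 -> mup 0 (h \Po ('X + a%:P)) = mup a h.
Proof.
move=> h0; have [m [f]] := multiplicity_XsubC h a; rewrite h0 /= => fa ->.
rewrite comp_polyM mupMr; last by rewrite /root horner_comp !hornerE.
rewrite mupMr // mup_XsubCX eqxx rmorphXn /= rmorphB /= comp_polyC comp_polyX.
by rewrite addrK -[X in X ^+ _]subr0 mup_XsubCX eqxx.
Qed.

(** A nonzero difference [d] would make [d * 'X + 1] nonconstant; at a root of it, which is not 0,
    [d] vanishes by hypothesis and leaves 1 = 0. *)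
Lemma poly_eq_off0 (k : closedFieldType) (f g : {poly k}) :
  (forall x, x != 0 -> f.[x] = g.[x]) -> f = g.
Proof.
move=> fg; apply/eqP; rewrite -subr_eq0; apply: contraT => d0.
have : exists x, root ((f - g) * 'X + 1) x.
  apply/closed_rootP; rewrite size_MXaddC (negPf d0) /= eqSS.
  by rewrite size_poly_eq0.
case=> x; rewrite /root !hornerE /=; have [->|x0] := eqVneq x 0.
  by rewrite mulr0 add0r oner_eq0.
by rewrite fg // subrr mul0r add0r oner_eq0.
Qed.

Definition is_bitangent F l := l != 0 /\
  forall p q : 'rV[K]_3, row_free (col_mx p q) ->
    p *m l^T = 0 -> q *m l^T = 0 ->
    restrict F p q != 0 /\
    (eval F p = 0 -> ~~ odd (intersection_mult F p q)).

(** In coordinates of a basis [p], [q] of the plane, the restriction is the square of some [g] of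
    degree at most 2. Homogenising [g] gives a binary quadratic form, which a matrix [A] extends to
    the whole space. *)
Lemma bitangent_sqrt F l : F \is ishomog1 4 mdeg -> is_bitangent F l ->
  exists A : 'M[K]_3, forall v, v *m l^T = 0 ->
    eval F v = (v *m A *m v^T) 0 0 ^+ 2.
Proof.
move=> homF [l0 bit]; have [p [q [fpq pl ql spanpq]]] := plane_basis l0.
have [h0 _] := bit _ _ fpq pl ql.
have [g hE] : exists g, restrict F p q = g ^+ 2.
  apply: even_mup_square => // a.
  have [ra|/mupNroot -> //] := boolP (root (restrict F p q) a).
  (* The hypothesis speaks of the multiplicity at the base point only, so the base point is moved to
     the root. *)
  rewrite -mup_comp_shift // -restrict_shift.
  have [|_] := bit _ _ (row_freeD a fpq) _ ql.
    by rewrite mulmxDl -scalemxAl pl ql scaler0 addr0.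
  by apply; rewrite -horner_restrict; apply/eqP.
have sg : (size g <= 3)%N.
  have g0 : g != 0 by apply: contraNneq h0 => g0; rewrite hE g0 expr0n.
  have := size_restrict p q homF; rewrite hE expr2 size_mul //.
  by case: (size g) => [|[|[|[|n]]]] //=; rewrite !addnS.
have gE x : g.[x] = g`_0 + g`_1 * x + g`_2 * x ^+ 2.
  rewrite (horner_coef_wide _ sg) !big_ord_recl big_ord0 /= expr0 mulr1 expr1.
  by rewrite addr0 addrA.
(* [B] sends a vector of the plane to its coordinates in the basis [p], [q]. *)
have [B BE] : exists B : 'M[K]_(3, 1 + 1),
    forall u : 'rV_(1 + 1), u *m col_mx p q *m B = u.
  by exists (pinvmx (col_mx p q)) => u; rewrite mulmxKp.
(* Upper triangular matrix of the form [g_0 s^2 + g_1 s t + g_2 t^2]. *)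
pose A2 : 'M[K]_(1 + 1) := block_mx (g`_0)%:M (g`_1)%:M 0 (g`_2)%:M.
exists (B *m A2 *m B^T) => v /spanpq[s [t vE]].
have vB : v *m B = row_mx s%:M t%:M.
  by rewrite -(BE (row_mx _ _)) mul_row_col !mul_scalar_mx vE.
have -> : (v *m (B *m A2 *m B^T) *m v^T) 0 0 =
    g`_0 * s ^+ 2 + g`_1 * s * t + g`_2 * t ^+ 2.
  rewrite !mulmxA vB -mulmxA -trmx_mul vB mul_row_block mulmx0 addr0 tr_row_mx.
  rewrite mul_row_col !tr_scalar_mx mulmxDl -!scalar_mxM !mxE /= !mulr1n; ring.
rewrite vE; have [->|s0] := eqVneq s 0; last first.
  rewrite (_ : _ + _ = s *: (p + (t / s) *: q)); last first.
    by rewrite scalerDr scalerA mulrC divfK.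
  rewrite (evalZ _ _ homF) -horner_restrict hE horner_exp gE; field.
  by [].
(* The point [q] is at infinity for the chart [p + x q]. For nonzero [x], [F(t q + x p)] is [x ^+ 4]
   times the value of [g ^+ 2] at [t / x]; both sides are polynomials in [x], so the formula extends
   to [x = 0]. *)
have : restrict F (t *: q) p =
    ((g`_0)%:P * 'X ^+ 2 + (g`_1 * t)%:P * 'X + (g`_2 * t ^+ 2)%:P) ^+ 2.
  apply: poly_eq_off0 => x x0; rewrite horner_restrict horner_exp.
  rewrite !hornerD hornerM hornerXn hornerM hornerX !hornerC.
  rewrite (_ : _ + _ = x *: (p + (t / x) *: q)); last first.
    by rewrite scalerDr scalerA mulrC divfK // addrC.
  rewrite (evalZ _ _ homF) -horner_restrict hE horner_exp gE; field.
  by [].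
move=> /(congr1 (fun f => f.[0])); rewrite horner_restrict horner_exp.
rewrite !hornerD hornerM hornerXn hornerM hornerX !hornerC.
rewrite !scale0r addr0 add0r => ->; congr (_ ^+ _); ring.
Qed.

(** Along a direction of the plane independent of [p], the multiplicity at [p] is even and positive,
    hence at least 2, so the derivative vanishes there. *)
Lemma bitangent_gradient F l p q : is_bitangent F l -> p != 0 ->
  p *m l^T = 0 -> q *m l^T = 0 -> eval F p = 0 ->
  \sum_i q 0 i * eval (mderiv i F) p = 0.
Proof.
move=> [l0 bit] p0 pl + Fp.
have tangent (x : 'rV_3) : row_free (col_mx p x) -> x *m l^T = 0 ->
    \sum_i x 0 i * eval (mderiv i F) p = 0.
  move=> f xl; have [h0 /(_ Fp) ev] := bit _ _ f pl xl.
  have : (1 < mup 0 (restrict F p x))%N.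
    have : (0 < mup 0 (restrict F p x))%N.
      by rewrite -XsubC_dvd // dvdp_XsubCl /root horner_restrict scale0r addr0 Fp.
    by move: ev; rewrite /intersection_mult; case: (mup _ _) => [|[]].
  rewrite mup_geq // => /dvdpP[k hE].
  have : (restrict F p x)^`().[0] = 0.
    rewrite hE subr0 expr2 mulrA derivM derivX hornerD hornerM hornerX mulr0.
    by rewrite mulr1 hornerM hornerX mulr0 addr0.
  rewrite deriv_restrict horner_sum => e; rewrite -[RHS]e; apply: eq_bigr => i _.
  by rewrite hornerZ horner_restrict scale0r addr0.
have [x [y [fxy xl yl spanxy]]] := plane_basis l0.
have [z fz zl] : exists2 z : 'rV_3, row_free (col_mx p z) & z *m l^T = 0.
  have [[t xE]|nx] := pselect (exists t, x = t *: p); last first.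
    exists x => //; apply: row_free_pair => // s.
    by apply/eqP => xE; apply: nx; exists s.
  exists y => //; apply: row_free_pair => // s; apply/eqP => yE.
  exact: row_free_noncollinear fxy xE yE.
(* The direction [p] itself is the difference of the independent directions [z + p] and [z]. *)
have grad_p : \sum_i p 0 i * eval (mderiv i F) p = 0.
  have /tangent : row_free (col_mx p (z + p)).
    apply: row_free_pair => // t; apply/eqP => zE.
    apply: (@row_free_noncollinear _ p z p 1 (t - 1) fz); first by rewrite scale1r.
    by rewrite scalerBl scale1r -zE addrK.
  rewrite mulmxDl zl pl addr0 => /(_ erefl).
  under eq_bigr => i _ do rewrite mxE mulrDl.
  by rewrite big_split /= (tangent z) // add0r.
have [/asboolP[t ->] _|/asboolP nq ql] := boolP `[< exists t, q = t *: p >].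
  under eq_bigr => i _ do rewrite mxE -mulrA.
  by rewrite -big_distrr /= grad_p mulr0.
apply: tangent => //; apply: row_free_pair => // t.
by apply/eqP => qE; apply: nq; exists t.
Qed.

(* At a point of the curve both bitangents would be the tangent line. *)
Lemma bitangents_meet_off_curve F l l' v : smooth_quartic F ->
  is_bitangent F l -> is_bitangent F l' -> row_free (col_mx l l') ->
  v != 0 -> v *m l^T = 0 -> v *m l'^T = 0 -> eval F v != 0.
Proof.
move=> [homF smF] bl bl' f v0 vl vl'; apply/eqP => Fv.
have [i /eqP] := smF v v0 Fv; apply.
have [w wl wl'] := plane_sep f.
(* Every [x] is the sum of a vector of the plane of [l'] and a multiple of [w], which lies in the
   plane of [l]; the gradient kills both. *)
have grad (x : 'rV_3) : \sum_i x 0 i * eval (mderiv i F) v = 0.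
  pose c := (x *m l'^T) 0 0.
  have xl' : (x - c *: w) *m l'^T = 0.
    by rewrite mulmxBl -scalemxAl wl' scalemx1 -mx11_scalar subrr.
  rewrite -[x in LHS](subrK (c *: w)).
  under eq_bigr => j _ do rewrite mxE mulrDl.
  rewrite big_split /= (bitangent_gradient bl' v0 vl' xl' Fv) add0r.
  under eq_bigr => j _ do rewrite mxE -mulrA.
  by rewrite -big_distrr /= (bitangent_gradient bl v0 vl wl Fv) mulr0.
rewrite -(grad (delta_mx 0 i)) (bigD1 i) //= big1 => [|j ji]; rewrite mxE eqxx /=.
  by rewrite eqxx mul1r addr0.
by rewrite (negPf ji) mul0r.
Qed.

End Bitangent.

(** * Connected components and arcs *)

Section ConnectedComponents.
Variable T : topologicalType.
Implicit Types A U V D E : set T.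

Lemma connected_pairwise A :
  (forall x y, A x -> A y -> exists2 B, connected B & [/\ B x, B y & B `<=` A]) ->
  connected A.
Proof.
move=> pw; have [->|/set0P[x Ax]] := eqVneq A set0; first exact: connected0.
suff -> : A = connected_component A x by exact: component_connected.
apply/seteqP; split=> [y Ay|]; last exact: connected_component_sub.
have [B cB [Bx By BA]] := pw x y Ax Ay.
exact: (connected_component_max Bx BA cB).
Qed.

Lemma components_connected A : A !=set0 -> connected A -> components A = [set A].
Proof.
move=> [x Ax] cA; apply/seteqP; split=> [_ [y Ay <-]|_ ->].
  exact: connected_component_id.
by exists x => //; exact: connected_component_id.
Qed.

(** A connected [B] in the union that meets [U] cannot leave it: inside [B], the set [U] is closed,
    cut out by [D], and open, being the complement of [E]. *)
Lemma connected_component_clopen U V D E x : closed D -> closed E ->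
  U = (U `|` V) `&` D -> V = (U `|` V) `&` E -> U `&` V = set0 ->
  connected U -> U x -> connected_component (U `|` V) x = U.
Proof.
move=> cD cE UD VE UV0 cU Ux; apply/seteqP; split; last first.
  by apply: connected_component_max => //; exact: subsetUl.
move=> y [B [Bx BUV cB] By].
have BU : B `&` U = B.
  apply: cB; first by exists x.
    exists (~` E); first exact: closed_openC.
    apply/seteqP; split=> z [Bz]; last first.
      move=> nEz; split=> //; have [//|Vz] := BUV z Bz.
      by move: Vz; rewrite VE => -[_ /nEz].
    move=> Uz; split=> // Ez; suff : (U `&` V) z by rewrite UV0.
    by split=> //; rewrite VE; split => //; left.
  exists D => //; apply/seteqP; split=> z [Bz].
    by rewrite {1}UD => -[_ Dz].
  by move=> Dz; split=> //; rewrite UD; split => //; exact: BUV.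
by move: By; rewrite -BU => -[].
Qed.

Lemma components_clopen U V D E : closed D -> closed E ->
  U = (U `|` V) `&` D -> V = (U `|` V) `&` E -> U `&` V = set0 ->
  connected U -> connected V -> U !=set0 -> V !=set0 ->
  components (U `|` V) = [set U; V].
Proof.
move=> cD cE UD VE UV0 cU cV [u Uu] [v Vv].
have compU x : U x -> connected_component (U `|` V) x = U.
  exact: (connected_component_clopen cD cE).
have compV x : V x -> connected_component (U `|` V) x = V.
  rewrite setUC; apply: (connected_component_clopen cE cD) => //.
  - by rewrite setUC.
  - by rewrite setUC.
  - by rewrite setIC.
apply/seteqP; split=> [_ [y [Uy|Vy] <-]|_ [->|->]].
- by left; exact: compU.
- by right; exact: compV.
- by exists u; [left|exact: compU].
- by exists v; [right|exact: compV].
Qed.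

End ConnectedComponents.

(** * Arcs in the complex plane *)

Section Arcs.
Variable R : realType.
Local Notation K := (C R).

Lemma continuous_real_complex : continuous (fun s : R => s%:C%C : K).
Proof.
move=> s; apply: (@cvgrPdist_lt K K R (nbhs s) _ _ (s%:C%C)).2 => e e0.
have eE : e = (complex.Re e)%:C%C.
  by rewrite RRe_real // realE ltW.
have e'0 : 0 < complex.Re e by rewrite -ltcR -eE.
near=> t.
rewrite -rmorphB /= normc_def /= expr0n addr0 sqrtr_sqr eE ltcR.
near: t.
by exists (complex.Re e).
Unshelve. all: by end_near.
Qed.

Lemma notin_real (s : seq R) : exists r, r \notin s.
Proof.
(* One plus the sum of the absolute values exceeds every entry. *)
exists (1 + \sum_(x <- s) `|x|); apply/negP => /(big_rem _) /= e.
have := e _ _ _ predT (fun x => `|x|); rewrite /= => e'.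
have : 1 + \sum_(x <- s) `|x| <= \sum_(x <- s) `|x|.
  rewrite {2}e'; apply: le_trans (ler_norm _) _; rewrite lerDl.
  by apply: sumr_ge0.
by rewrite gerDr ler10.
Qed.

(* The arcs s + i r s (1 - s) from 0 to 1, r real, are pairwise disjoint off
   their end points, so that all but finitely many of them avoid the roots. *)
Lemma arc_avoid_roots (h : {poly K}) : h.[0] != 0 -> h.[1] != 0 ->
  exists u : R -> K, [/\ continuous u, u 0 = 0, u 1 = 1 & forall s, h.[u s] != 0].
Proof.
move=> h0 h1; have [rs hE] := closed_field_poly_normal h.
have hn0 : h != 0 by apply: contraNneq h0 => ->; rewrite horner0.
(* [bad z] is the parameter of the only arc through [z]. Where the real part of [z] is 0 or 1, the
   default value of the division does no harm: an arc has such a real part only at its end points,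
   which are no roots. *)
pose bad (z : K) := complex.Im z / (complex.Re z * (1 - complex.Re z)).
have [r rP] := notin_real (map bad rs).
pose u (s : R) : K := s%:C%C * (1 + 'i%C * r%:C%C * (1 - s%:C%C)).
have uE s : u s = (s +i* (r * s * (1 - s)))%C.
  apply/eqP; rewrite eq_complex; simpc; rewrite /=.
  by apply/andP; split; apply/eqP; ring.
exists u; split.
- move=> s; apply: cvgM; first exact: continuous_real_complex.
  apply: cvgD; first exact: cvg_cst.
  apply: cvgM; first exact: cvg_cst.
  apply: cvgD; first exact: cvg_cst.
  by apply: cvgN; exact: continuous_real_complex.
- by rewrite /u rmorph0 mul0r.
- by rewrite /u rmorph1 subrr mulr0 addr0 mulr1.
move=> s; apply/negP => hus.
have : u s \in rs.
  move: hus; rewrite hE hornerZ mulf_eq0 lead_coef_eq0 (negPf hn0) /=.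
  by rewrite -/(root _ _) root_prod_XsubC.
move=> us; case/negP: rP; apply/mapP; exists (u s) => //.
rewrite /bad uE /=.
have s0 : s != 0.
  by apply: contraNneq h0 => s0; move: hus; rewrite s0 /u rmorph0 mul0r.
have s1 : 1 - s != 0.
  rewrite subr_eq0 eq_sym; apply: contraNneq h1 => s1.
  by move: hus; rewrite s1 /u rmorph1 subrr mulr0 addr0 mulr1.
by rewrite -mulrA mulfK // mulf_neq0.
Qed.

Lemma continuous_sum (T : topologicalType) (I : Type) (r : seq I) (f : I -> T -> K) :
  (forall i, continuous (f i)) -> continuous (fun x => \sum_(i <- r) f i x).
Proof.
move=> cf; elim: r => [|i r IHr] x.
  rewrite (_ : (fun _ => _) = cst 0); last by apply/funext => y; rewrite big_nil.
  exact: cvg_cst.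
rewrite (_ : (fun _ => _) = fun y => f i y + \sum_(j <- r) f j y); last first.
  by apply/funext => y; rewrite big_cons.
by apply: cvgD; [exact: cf|exact: IHr].
Qed.

End Arcs.

(** * Sheets of the double cover *)

Section Sheets.
Variable R : realType.
Local Notation K := (C R).
Local Open Scope quotient_scope.
Implicit Types (A : 'M[K]_3) (l v : 'rV[K]_3) (b : bool) (y : O2 R).

Definition quad A v : K := (v *m A *m v^T) 0 0.

Lemma quadZ A t v : quad A (t *: v) = t ^+ 2 * quad A v.
Proof. by rewrite /quad linearZ /= -!scalemxAl -scalemxAr scalerA mxE. Qed.

Lemma quad0 A : quad A 0 = 0.
Proof. by rewrite /quad !mul0mx mxE. Qed.

(** On a complex line a quadratic form is a polynomial in the parameter, to which [arc_avoid_roots]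
    applies. *)
Lemma quad_along_line A v v' :
  exists h : {poly K}, forall u, quad A (v + u *: v') = h.[u].
Proof.
exists ((quad A v)%:P + ((v *m A *m v'^T) 0 0 + (v' *m A *m v^T) 0 0)%:P * 'X +
        (quad A v')%:P * 'X * 'X) => u.
rewrite !hornerD !hornerM !hornerX !hornerC /quad linearD linearZ /=.
rewrite !mulmxDl -!scalemxAl !mulmxDr -!scalemxAr !mxE; ring.
Qed.

Lemma continuous_mul_tr l : continuous (fun v => (v *m l^T) 0 0).
Proof.
have -> : (fun v => (v *m l^T) 0 0) = fun v => \sum_j v 0 j * l^T j 0.
  by apply/funext => v; rewrite mxE.
have cl j : continuous (fun v : 'rV[K]_3 => v 0 j * l^T j 0).
  by move=> v; apply: (@cvgM _ _ (nbhs v)); [exact: coord_continuous|exact: cvg_cst].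
exact: (continuous_sum cl).
Qed.

Lemma continuous_quad A : continuous (quad A).
Proof.
have -> : quad A = fun v => \sum_j (\sum_i v 0 i * A i j) * v 0 j.
  by apply/funext => v; rewrite /quad mxE; apply: eq_bigr => j _; rewrite !mxE.
have cA i j : continuous (fun v : 'rV[K]_3 => v 0 i * A i j).
  by move=> v; apply: (@cvgM _ _ (nbhs v)); [exact: coord_continuous|exact: cvg_cst].
have cA' j : continuous (fun v : 'rV[K]_3 => \sum_i v 0 i * A i j).
  exact: (continuous_sum (cA ^~ j)).
have cAv j : continuous (fun v : 'rV[K]_3 => (\sum_i v 0 i * A i j) * v 0 j).
  by move=> v; apply: (@cvgM _ _ (nbhs v)); [exact: cA'|exact: coord_continuous].
exact: (continuous_sum cAv).
Qed.

Definition lift4 v (w : K) (v0 : v != 0) : affine4 (R := R) :=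
  exist _ (v, w) (mem_set (v0 : affine4 (v, w))).

Lemma repr_O2 (x : affine4 (R := R)) : exists2 t : K, t != 0 &
  set_val (repr (\pi_(O2 R) x)) = (t *: (set_val x).1, t ^+ 2 * (set_val x).2).
Proof.
have : weighted_proportional x (repr (\pi_(O2 R) x)).
  by apply/eqmodP; rewrite reprK.
by move=> /asboolP.
Qed.

(** The closed conditions for lying on a sheet, without the open one [quad A v != 0]; they give the
    closed sets that separate the components. *)
Definition on_sheet l A b (x : 'rV[K]_3 * K) : Prop :=
  x.1 *m l^T = 0 /\ x.2 = (-1) ^+ b * quad A x.1.

Lemma on_sheetZ l A b t v w : t != 0 ->
  on_sheet l A b (t *: v, t ^+ 2 * w) <-> on_sheet l A b (v, w).
Proof.
move=> t0; rewrite /on_sheet /= -scalemxAl quadZ mulrCA.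
have t20 : t ^+ 2 != 0 by rewrite expf_neq0.
split=> -[].
  move=> /eqP; rewrite scaler_eq0 (negPf t0) => /eqP vl /(mulfI t20) -> //.
by move=> -> ->; rewrite scaler0.
Qed.

Definition sheet l A b : set (O2 R) :=
  [set y | on_sheet l A b (set_val (repr y)) /\ quad A (set_val (repr y)).1 != 0].

Lemma sheet_pi l A b (x : affine4 (R := R)) :
  sheet l A b (\pi_(O2 R) x) <->
  on_sheet l A b (set_val x) /\ quad A (set_val x).1 != 0.
Proof.
have [t t0 e] := repr_O2 x; rewrite /sheet /= e /= quadZ mulf_eq0 negb_or.
by rewrite expf_neq0 //= on_sheetZ // -surjective_pairing.
Qed.

(** A set of the quotient is closed when its preimage is; the two equations are homogeneous for the
    weights of O(2), so the preimage is the zero set of continuous functions. *)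
Lemma closed_on_sheet l A b :
  closed [set y : O2 R | on_sheet l A b (set_val (repr y))].
Proof.
suff cl : closed [set x : affine4 (R := R) | on_sheet l A b (set_val x)].
  pose D := [set y : O2 R | on_sheet l A b (set_val (repr y))].
  have DE : \pi_(O2 R) @^-1` D = [set x | on_sheet l A b (set_val x)].
    apply/seteqP; split=> x; rewrite /D /preimage /=; have [t t0 ->] := repr_O2 x;
      by rewrite on_sheetZ // -surjective_pairing.
  by rewrite -openC; move: cl; rewrite -openC -DE.
have cl0 : closed [set (0 : K)].
  exact/accessible_closed_set1/hausdorff_accessible/norm_hausdorff.
have cf (f : 'rV[K]_3 * K -> K) : continuous f ->
    closed [set x : affine4 (R := R) | f (set_val x) = 0].
  move=> ctf; apply: (@preimage_closed _ _ (f \o set_val) [set 0]) => //.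
  move=> x _; apply: continuous_comp; last exact: ctf.
  exact: (@initial_continuous _ _ (@set_val _ (affine4 (R := R)))).
rewrite (_ : mkset _ =
    [set x : affine4 (R := R) | ((set_val x).1 *m l^T) 0 0 = 0] `&`
    [set x : affine4 (R := R) | (set_val x).2 - (-1) ^+ b * quad A (set_val x).1 = 0]).
  apply: closedI.
    apply: (cf (fun x => (x.1 *m l^T) 0 0)) => x.
    apply: (@continuous_comp _ _ _ fst (fun v => (v *m l^T) 0 0) x).
      exact: cvg_fst.
    exact: continuous_mul_tr.
  apply: (cf (fun x => x.2 - (-1) ^+ b * quad A x.1)) => x.
  apply: (@cvgD _ _ _ (nbhs x)); first exact: cvg_snd.
  apply: (@cvgN _ _ _ (nbhs x)); apply: (@cvgM _ _ (nbhs x)); first exact: cvg_cst.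
  apply: (@continuous_comp _ _ _ fst (quad A) x); first exact: cvg_fst.
  exact: continuous_quad.
apply/seteqP; split=> x /=; rewrite /on_sheet.
  by move=> [-> ->]; rewrite mxE subrr.
move=> [e /eqP]; rewrite subr_eq0 => /eqP; split=> //.
by rewrite (mx11_scalar (_ *m _)) e raddf0.
Qed.

(** The sheet is a graph over the plane minus the zeros of [quad A]. On the complex line through two
    points of the plane, [quad A] is a polynomial not vanishing at the parameters 0 and 1, and an
    arc avoiding its roots lifts to the sheet. *)
Lemma sheet_connected l A b : connected (sheet l A b).
Proof.
apply: connected_pairwise => y1 y2.
rewrite -(reprK y1) -(reprK y2) => /sheet_pi[[v1l w1E] q1] /sheet_pi[[v2l w2E] q2].
set x1 := repr y1 in v1l w1E q1 *; set x2 := repr y2 in v2l w2E q2 *.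
set v1 := (set_val x1).1 in v1l w1E q1; set v2 := (set_val x2).1 in v2l w2E q2.
have [h hE] := quad_along_line A v1 (v2 - v1).
have [||u [cu u0 u1 hu]] := @arc_avoid_roots R h.
- by rewrite -hE scale0r addr0.
- by rewrite -hE scale1r addrC subrK.
pose v s := v1 + u s *: (v2 - v1).
pose w s := (-1) ^+ b * quad A (v s).
(* [quad A] vanishes at the origin, so the arc avoids it too, even when [v1] and [v2] are
   proportional. *)
have v0 s : v s != 0.
  by apply: contraNneq (hu s) => vs; rewrite -hE -/(v s) vs quad0.
pose g s : affine4 (R := R) := lift4 (w s) (v0 s).
have v_cont : continuous v.
  move=> s; apply: cvgD; first exact: cvg_cst.
  by apply: cvgZr_tmp; exact: cu.
have w_cont : continuous w.
  move=> s; apply: (@cvgM _ _ (nbhs s)); first exact: cvg_cst.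
  apply: (@continuous_comp _ _ _ v (quad A) s); first exact: v_cont.
  exact: continuous_quad.
have vw_cont : continuous (fun s => (v s, w s)).
  by move=> s; exact: (cvg_pair (v_cont s) (w_cont s)).
have g_cont : continuous g by apply: continuous_comp_initial; exact: vw_cont.
exists ((\pi_(O2 R) \o g) @` setT).
  apply: connected_continuous_connected; first by apply/connected_intervalP.
  apply: continuous_subspaceT => s; apply: continuous_comp; first exact: g_cont.
  exact: pi_continuous.
split.
- exists 0 => //=; congr (\pi_(O2 R) _); apply: val_inj => /=.
  by rewrite /w /v u0 scale0r addr0 -w1E -surjective_pairing.
- exists 1 => //=; congr (\pi_(O2 R) _); apply: val_inj => /=.
  by rewrite /w /v u1 scale1r addrC subrK -w2E -surjective_pairing.
move=> _ [s _ <-] /=; apply/sheet_pi => /=; rewrite /on_sheet /=; split; last first.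
  by rewrite hE.
split=> //.
by rewrite mulmxDl -scalemxAl mulmxBl v1l v2l subrr scaler0 addr0.
Qed.

End Sheets.

(** * Connected number of three bitangents *)

Section Cover.
Variable R : realType.
Local Notation K := (C R).
Local Open Scope quotient_scope.
Implicit Types (F : mpoly 3 K) (A : 'M[K]_3) (l v : 'rV[K]_3) (b e : bool) (y : O2 R).

Lemma coords_pi (x : affine3 (R := R)) : exists2 t : K, t != 0 &
  coords (\pi_(P2 R) x) = t *: set_val x.
Proof.
have : proportional x (repr (\pi_(P2 R) x)) by apply/eqmodP; rewrite reprK.
by move=> /asboolP.
Qed.

Lemma line_pi l (x : affine3 (R := R)) :
  line l (\pi_(P2 R) x) <-> set_val x *m l^T = 0.
Proof.
have [t t0 e] := coords_pi x; rewrite /line /= e -scalemxAl.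
split=> [/eqP|->]; last by rewrite scaler0.
by rewrite scaler_eq0 (negPf t0) => /eqP.
Qed.

Lemma curve_pi F d (x : affine3 (R := R)) : F \is ishomog1 d mdeg ->
  curve F (\pi_(P2 R) x) <-> eval F (set_val x) = 0.
Proof.
move=> homF; have [t t0 e] := coords_pi x; rewrite /curve /= e (evalZ _ _ homF).
split=> [/eqP|->]; last by rewrite mulr0.
by rewrite mulf_eq0 expf_eq0 (negPf t0) andbF => /eqP.
Qed.

Lemma row_free_lines l l' : l != 0 -> l' != 0 -> line l != line l' ->
  row_free (col_mx l l').
Proof.
move=> l0 l'0 ll'; apply: row_free_pair => // t; apply: contra_neqN ll' => /eqP l'E.
have t0 : t != 0 by apply: contraNneq l'0 => t0; rewrite l'E t0 scale0r.
apply/seteqP; split=> P; rewrite /line /= l'E linearZ /= -scalemxAr.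
  by move=> ->; rewrite scaler0.
by move=> /eqP; rewrite scaler_eq0 (negPf t0) => /eqP.
Qed.

Definition is_sqrt_on F l A := forall v, v *m l^T = 0 -> eval F v = quad A v ^+ 2.

Definition same_up_to_sign l A l' A' b := forall v,
  v *m l^T = 0 -> v *m l'^T = 0 -> quad A v = (-1) ^+ b * quad A' v.

(** At a generator of the intersection of the two planes the two square roots have equal squares;
    both are homogeneous of degree 2, so the sign found there holds on the whole intersection. *)
Lemma sqrt_sign F l A l' A' : row_free (col_mx l l') ->
  is_sqrt_on F l A -> is_sqrt_on F l' A' -> exists b, same_up_to_sign l A l' A' b.
Proof.
move=> f sA sA'; have [p p0 [pl pl' pE]] := plane_meet f.
have : quad A p ^+ 2 = quad A' p ^+ 2 by rewrite -sA // -sA'.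
move=> /eqP; rewrite eqf_sqr => /orP[] /eqP qE; [exists false|exists true];
  move=> v vl vl'; have [t ->] := pE v vl vl'; rewrite !quadZ qE ?mul1r //.
by rewrite expr1 mulN1r mulrN.
Qed.

(** The lines meet off the quartic, and the point of the first sheet over their common point also
    lies on the second sheet of matching sign. *)
Lemma sheet_meet F l A l' A' b e : smooth_quartic F ->
  is_bitangent F l -> is_bitangent F l' -> row_free (col_mx l l') ->
  is_sqrt_on F l A -> same_up_to_sign l A l' A' b ->
  sheet l A e `&` sheet l' A' (e (+) b) !=set0.
Proof.
move=> smF bl bl' f sA sg; have [p p0 [pl pl' _]] := plane_meet f.
have qA : quad A p != 0.
  have := bitangents_meet_off_curve smF bl bl' f p0 pl pl'.
  by rewrite sA // expf_eq0.
exists (\pi_(O2 R) (lift4 ((-1) ^+ e * quad A p) p0)).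
split; apply/sheet_pi; rewrite /on_sheet /=; split=> //.
  by split=> //; rewrite sg // signr_addb mulrA.
by move: qA; rewrite sg // mulf_eq0 signr_eq0.
Qed.

(** At a common point [quad A'] is nonzero and can be cancelled, which leaves an equation between
    signs. *)
Lemma sheet_disjoint l A l' A' b e e' y : same_up_to_sign l A l' A' b ->
  sheet l A e y -> sheet l' A' e' y -> e' = e (+) b.
Proof.
move=> sg [[yl yE] q] [[yl' yE'] q']; apply/eqP.
move: yE; rewrite yE' sg // mulrA -signr_addb => /(mulIf q') /eqP.
by rewrite (inj_eq signr_inj).
Qed.

Lemma cover_sheet F l A y : F \is ishomog1 4 mdeg -> is_sqrt_on F l A ->
  double_cover F y /\ (line l `\` curve F) (O2_proj y) <->
  exists b, sheet l A b y.
Proof.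
move=> homF sA; rewrite /double_cover /O2_proj /=; split.
  move=> [yE [/line_pi /= yl ncF]].
  have Fy : eval F (set_val (repr y)).1 != 0.
    by apply/eqP => Fy; apply: ncF; apply/(curve_pi _ homF).
  move: yE; rewrite sA // => /eqP; rewrite eqf_sqr => /orP[] /eqP yE;
    [exists false|exists true]; split; rewrite /on_sheet ?yE ?mul1r ?expr1 ?mulN1r //;
    by move: Fy; rewrite sA // expf_eq0.
move=> [b [[yl yE] q]]; split; first by rewrite yE sA // exprMn sqrr_sign mul1r.
split; first by apply/line_pi.
by move/(curve_pi _ homF) => /= /eqP; rewrite sA // expf_eq0 (negPf q).
Qed.

(** Lying on one sheet already forces the point off the quartic, so only the closed conditions
    remain for the other line. *)
Lemma on_sheet_sheet F l A l' A' b b' y :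
  is_sqrt_on F l A -> is_sqrt_on F l' A' -> sheet l A b y ->
  on_sheet l' A' b' (set_val (repr y)) -> sheet l' A' b' y.
Proof.
move=> sA sA' [[yl _] q] yl'; split=> //; case: yl' => yl' _.
have := sA _ yl; rewrite sA' // => /eqP; apply: contraTneq => ->.
by rewrite expr0n eq_sym expf_eq0 q.
Qed.

(** The six sheets form a graph doubly covering a triangle whose vertices are the lines and whose
    edges carry the signs. It is connected exactly when going round the triangle exchanges the two
    sheets, that is, when the signs have odd sum. *)
Lemma connected_number_triangle F (l : 'I_3 -> 'rV[K]_3) (A : 'I_3 -> 'M[K]_3)
    (s : 'I_3 -> 'I_3 -> bool) :
  smooth_quartic F ->
  (forall i, is_bitangent F (l i)) -> (forall i, is_sqrt_on F (l i) (A i)) ->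
  (forall i j, i != j -> row_free (col_mx (l i) (l j))) ->
  (forall i j, i != j -> same_up_to_sign (l i) (A i) (l j) (A j) (s i j)) ->
  connected_number F (\bigcup_i line (l i)) =
  if s 0 1 (+) s 1 2 (+) s 0 2 then 1%N else 2.
Proof.
move=> smF bit sA f sg.
have homF : F \is ishomog1 4 mdeg by case: smF.
pose sh i e := sheet (l i) (A i) e.
have meet i j e : i != j -> sh i e `&` sh j (e (+) s i j) !=set0.
  by move=> ij; exact: (sheet_meet e smF (bit i) (bit j) (f i j ij) (sA i) (sg i j ij)).
have shN0 i e : sh i e !=set0.
  have [j ij] : exists j : 'I_3, i != j.
    by case: (ord3P i) => ->; [exists 1|exists 0|exists 0].
  by have [y [hy _]] := meet i j e ij; exists y.
have s_sym i j : i != j -> s i j = s j i.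
  move=> ij; have [y [yi yj]] := meet i j false ij.
  have ji : j != i by rewrite eq_sym.
  by have := sheet_disjoint (sg _ _ ji) yj yi; case: (s i j) (s j i) => [] [].
(* Gluing along the intersections with line 0 only leaves the two connected sets
   U e; the intersection of lines 1 and 2 joins them iff the three signs do not
   cancel. *)
pose o i := if i == 0 then false else s 0 i.
pose U e := sh 0 (e (+) o 0) `|` sh 1 (e (+) o 1) `|` sh 2 (e (+) o 2).
have UP e y : U e y <-> exists i, sh i (e (+) o i) y.
  split=> [[[h|h]|h]|[k]]; [by exists 0|by exists 1|by exists 2|].
  by case: (ord3P k) => ->; [left; left|left; right|right].
(* The closed set [D e] will cut [U e] out of the whole preimage, as [components_clopen]
   requires. *)
pose csh i e := [set y : O2 R | on_sheet (l i) (A i) e (set_val (repr y))].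
pose D e := csh 0 (e (+) o 0) `|` csh 1 (e (+) o 1) `|` csh 2 (e (+) o 2).
have DP e y : D e y <-> exists i, csh i (e (+) o i) y.
  split=> [[[h|h]|h]|[k]]; [by exists 0|by exists 1|by exists 2|].
  by case: (ord3P k) => ->; [left; left|left; right|right].
have cD e : closed (D e) by do 2?apply: closedU; exact: closed_on_sheet.
have UUP y : (U false `|` U true) y <-> exists i b, sh i b y.
  split=> [[] /UP[i hi]|[i [b hi]]]; [by exists i, (o i)|by exists i, (~~ o i)|].
  have : U (b (+) o i) y by apply/UP; exists i; rewrite addbK.
  by case: (b (+) o i); [right|left].
have YE : double_cover F `&` @O2_proj R @^-1` ((\bigcup_i line (l i)) `\` curve F) =
    U false `|` U true.
  apply/seteqP; split=> y.
    move=> [dy [[i _ ly] ncF]]; apply/UUP; exists i.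
    exact/(cover_sheet y homF (sA i)).
  move=> /UUP[i /(cover_sheet y homF (sA i))[dy [ly ncF]]].
  by split=> //; split=> //; exists i.
have UN0 e : U e !=set0.
  by have [y hy] := shN0 0 (e (+) o 0); exists y; apply/UP; exists 0.
have cU e : connected (U e).
  apply: connectedU; last exact: sheet_connected.
    have [y [h0 h2]] := meet 0 2 e isT.
    by exists y; split=> //; left; rewrite addbF.
  apply: connectedU; [|exact: sheet_connected|exact: sheet_connected].
  by rewrite addbF; exact: meet.
have UD e : U e = (U false `|` U true) `&` D e.
  apply/seteqP; split=> y.
    move=> /UP[i hi]; split; first by apply/UUP; exists i, (e (+) o i).
    by apply/DP; exists i; case: hi.
  move=> [/UUP[i [b hi]] /DP[j hj]]; apply/UP; exists j.
  exact: on_sheet_sheet (sA i) (sA j) hi hj.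
rewrite /connected_number YE; case: ifPn => sE.
  rewrite components_connected.
  - by rewrite fset_set1 cardfs1.
  - by have [y Uy] := UN0 false; exists y; left.
  apply: connectedU => //.
  have [y [h1 h2]] := meet 1 2 (o 1) isT.
  exists y; split; apply/UP; first by exists 1.
  exists 2; move: h2; congr (sh _ _ y).
  by move: sE; rewrite /o /=; case: (s 0 1) (s 1 2) (s 0 2) => [] [] [].
(* Now the signs cancel, so [s] is the coboundary of [o]: relabelling the sheets of line [i] by
   [o i] makes all gluings trivial. *)
have sE' i j : i != j -> s i j = o i (+) o j.
  have [s10 s21 s20] : [/\ s 1 0 = s 0 1, s 2 1 = s 1 2 & s 2 0 = s 0 2].
    by split; apply: s_sym.
  by case: (ord3P i) => ->; case: (ord3P j) => -> //= _; rewrite /o /= ?s10 ?s20 ?s21;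
    move: sE; case: (s 0 1) (s 1 2) (s 0 2) => [] [] [].
have U0 : U false `&` U true = set0.
  apply/seteqP; split=> // y [/UP[i hi] /UP[j hj]].
  suff : true (+) o j = false (+) o i (+) (o i (+) o j).
    by case: (o i) (o j) => [] [].
  (* Sheets over different lines are compared through [sE'], sheets over one line through the
     trivial sign [false]. *)
  have [ij|ij] := eqVneq i j; last first.
    by rewrite -sE' //; exact: sheet_disjoint (sg i j ij) hi hj.
  rewrite -ij addbb; apply: (@sheet_disjoint (l i) (A i) (l i) (A i) _ _ _ y _ hi).
    by move=> v _ _; rewrite mul1r.
  by rewrite ij.
rewrite (components_clopen (cD false) (cD true)) //.
rewrite fset_setU ?fset_set1 // cardfs2; case: eqP => // UE.
by have [y Uy] := UN0 false; have : (U false `&` U true) y; [rewrite -UE|rewrite U0].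
Qed.

End Cover.

(** * Counting *)

Lemma card_fset_set_image (T : finType) (U : choiceType) (f : T -> U) (B : {set T}) :
  {in B &, injective f} -> #|` fset_set [set f x | x in [set` B]]| = #|B|.
Proof.
move=> injf; apply: card_fset_set.
have /card_eql -> : ([set f x | x in [set` B]] #= [set` B])%card.
  by apply: inj_card_eq => x y; rewrite !inE; exact: injf.
rewrite (_ : [set` B] = [set` [fset x in B]%fset]); last first.
  by apply/seteqP; split=> x /=; rewrite !inE.
by apply/card_eq_fsetP; rewrite card_imfset //= cardE.
Qed.

(** The first entry is twice some [k] at most [c./2] and determines the second, which leaves at most
    [c./2 + 1] pairs. *)
Lemma even_pairs_card (P : set (nat * nat)) (c : nat) :
  (forall p, P p -> ~~ odd p.1 /\ (p.1 + p.2)%N = c) ->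
  finite_set P /\ (#|` fset_set P|%:R <= 2^-1 * c%:R + 1 :> rat).
Proof.
move=> Pp; have leP : (P #<= `I_(c./2.+1))%card.
  apply: (card_le_trans _ (card_image_le (fun k => (k.*2, c - k.*2)%N) _)).
  apply: subset_card_le => -[a b] /Pp[/= eva <-]; exists a./2.
    by rewrite /= ltnS half_leq // leq_addr.
  by rewrite even_halfK // addKn.
split; first by apply/finite_set_leP; exists c./2.+1.
have := geq_card_fset_set leP; rewrite -(ler_nat rat) => /le_trans; apply.
rewrite -natr1 lerD2r -{2}(odd_double_half c) natrD -muln2 natrM.
rewrite mulrDr mulrCA mulVf ?mulr1 // lerDr mulr_ge0 //.
Qed.

Section Counting.
Variable R : realType.
Local Notation K := (C R).

Lemma bitangentsP (F : mpoly 3 K) (X : set (P2 R)) :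
  bitangents F X -> exists2 l, is_bitangent F l & X = line l.
Proof. by move=> [l l0 [XE bit]]; exists l. Qed.

(** The restrictions of [F] and of the linear forms [l' j] are nonzero polynomials, so their product
    has a non-root. This serves to tell sums of bitangents apart. *)
Lemma line_point_off (F : mpoly 3 K) (T : eqType) (l : 'rV[K]_3) (js : seq T)
    (l' : T -> 'rV[K]_3) :
  is_bitangent F l -> (forall j, j \in js -> row_free (col_mx l (l' j))) ->
  exists2 v, v *m l^T = 0 & eval F v != 0 /\ forall j, j \in js -> v *m (l' j)^T != 0.
Proof.
move=> [l0 bit] fl; have [p [q [fpq pl ql spanpq]]] := plane_basis l0.
have [h0 _] := bit p q fpq pl ql.
pose g j : {poly K} := ((p *m (l' j)^T) 0 0)%:P + ((q *m (l' j)^T) 0 0) *: 'X.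
have gE j t : (g j).[t] = ((p + t *: q) *m (l' j)^T) 0 0.
  by rewrite /g hornerD hornerC hornerZ hornerX mulmxDl -scalemxAl !mxE mulrC.
have g0 j : j \in js -> g j != 0.
  move=> /fl/plane_sep[w wl wl']; have [s [t wE]] := spanpq w wl.
  apply: contra_eq_neq wl' => g0; rewrite wE mulmxDl -!scalemxAl.
  have p0 : p *m (l' j)^T = 0.
    have := gE j 0; rewrite g0 horner0 scale0r addr0 => e.
    by rewrite (mx11_scalar (p *m _)) -e raddf0.
  have q0 : q *m (l' j)^T = 0.
    have := gE j 1; rewrite g0 horner0 scale1r mulmxDl p0 add0r => e.
    by rewrite (mx11_scalar (q *m _)) -e raddf0.
  by rewrite p0 q0 !scaler0 addr0 eq_sym oner_neq0.
have /closed_nonrootP[t] : restrict F p q * \prod_(j <- js) g j != 0.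
  by rewrite mulf_neq0 // prodf_seq_neq0; apply/allP => j /g0.
rewrite rootM negb_or => /andP[Ft gt]; exists (p + t *: q).
  by rewrite mulmxDl -scalemxAl pl ql scaler0 addr0.
split; first by rewrite -horner_restrict.
move=> j js_j; apply: contraNneq gt => e.
rewrite /root horner_prod prodf_seq_eq0; apply/hasP; exists j => //=.
by rewrite gE e mxE.
Qed.

Variables (F : mpoly 3 K) (L : 'I_28 -> set (P2 R)).
Hypotheses (smF : smooth_quartic F) (bijL : set_bij [set: 'I_28] (bitangents F) L).

Lemma bitangent_lines : exists l : 'I_28 -> 'rV[K]_3,
  [/\ forall i, is_bitangent F (l i), forall i, L i = line (l i) &
      forall i j, i != j -> row_free (col_mx (l i) (l j))].
Proof.
have [_ injL _] := bijL.
have /choice[l lP] i : exists l, is_bitangent F l /\ L i = line l.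
  have /bitangentsP[l bl LE] : bitangents F (L i) by have [+ _ _] := bijL; apply.
  by exists l.
exists l; split=> [i|i|i j ij]; [exact: (lP i).1|exact: (lP i).2|].
apply: row_free_lines; [by have [[]] := lP i|by have [[]] := lP j|].
by rewrite -(lP i).2 -(lP j).2; apply: contra_neq ij => /injL; apply; rewrite inE.
Qed.

Lemma bitangent_signs : exists s : rel 'I_28, (forall i j, s i j = s j i) /\
  forall J : {set 'I_28}, #|J| = 3 ->
    connected_number F (sum_lines L J) = if odd (pair_count s J) then 1%N else 2.
Proof.
have [l [bit LE f]] := bitangent_lines.
have homF : F \is ishomog1 4 mdeg by case: smF.
have /choice[A sA] i : exists A, is_sqrt_on F (l i) A.
  by have [A AE] := bitangent_sqrt homF (bit i); exists A.
have /choice[s0 s0P] (ij : 'I_28 * 'I_28) : exists b : bool, ij.1 != ij.2 ->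
    same_up_to_sign (l ij.1) (A ij.1) (l ij.2) (A ij.2) b.
  have [e|ij12] := eqVneq ij.1 ij.2; first by exists false.
  by have [b sg] := sqrt_sign (f _ _ ij12) (sA ij.1) (sA ij.2); exists b.
(* The chosen signs [s0] need not be symmetric; reading them at the increasing pair makes them
   so. *)
pose s (i j : 'I_28) := if (i < j)%N then s0 (i, j) else s0 (j, i).
have s_sym i j : s i j = s j i.
  by rewrite /s; case: ltngtP => // /ord_inj ->.
have sg i j : i != j -> same_up_to_sign (l i) (A i) (l j) (A j) (s i j).
  move=> ij; rewrite /s; case: ifP => _; first exact: (s0P (i, j)).
  move=> v vi vj; rewrite (s0P (j, i) _ v vj vi) /= 1?eq_sym //.
  by rewrite mulrA -signr_addb addbb mul1r.
exists s; split=> // J J3.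
pose g (i : 'I_3) : 'I_28 := enum_val (cast_ord (esym J3) i).
have injg : injective g by move=> x y /enum_val_inj/cast_ord_inj.
have gJ : J = (g @: [set: 'I_3]%SET).
  apply/eqP; rewrite eq_sym eqEcard card_imset // cardsT card_ord J3 leqnn andbT.
  by apply/fintype.subsetP => _ /imsetP[k _ ->]; exact: enum_valP.
rewrite {2}gJ pair_count_image //.
have -> : sum_lines L J = \bigcup_i line (l (g i)).
  rewrite /sum_lines; apply/seteqP; split=> P [k].
    rewrite /= gJ => /imsetP[m _ ->] LP; exists m => //.
    by rewrite -LE.
  by move=> _ lP'; exists (g k); [exact: enum_valP|rewrite LE].
rewrite (@connected_number_triangle _ F (l \o g) (A \o g)
  (fun i j => s (g i) (g j))) //=.
- by rewrite !oddD !oddb.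
- by move=> i j ij; apply: f; rewrite (inj_eq injg).
- by move=> i j ij; apply: sg; rewrite (inj_eq injg).
Qed.

(** A bitangent outside [J'] has a point off the quartic and off all lines of [J']. Hence counting
    curves in [c_fiber] is counting triples. *)
Lemma curve_sum_lines_inj : injective (fun J => curve F `|` sum_lines L J).
Proof.
suff sub (J J' : {set 'I_28}) :
    curve F `|` sum_lines L J = curve F `|` sum_lines L J' ->
    J \subset J'.
  by move=> J J' /= e; apply/eqP; rewrite finset.eqEsubset !sub.
have [l [bit LE f]] := bitangent_lines.
move=> e; apply/fintype.subsetP => i iJ; apply: contraT => iJ'.
have [j|v vi [Fv vj]] := @line_point_off F _ (l i) (enum J') l (bit i).
  by rewrite mem_enum => jJ'; apply: f; apply: contraNneq iJ' => ->.
have v0 : v != 0.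
  apply: contraNneq Fv => ->; have [homF _] := smF.
  by rewrite -(scale0r 0) (evalZ _ _ homF) expr0n mul0r.
pose x : affine3 (R := R) := exist _ v (mem_set (v0 : affine3 v)).
have : (curve F `|` sum_lines L J) (\pi_(P2 R) x)%qT.
  by right; exists i => //; rewrite LE; apply/line_pi.
rewrite e => -[|[j jJ']].
  have [homF _] := smF.
  by move/(curve_pi _ homF) => /= /eqP; rewrite (negPf Fv).
rewrite LE => /line_pi /= /eqP; rewrite (negPf (vj j _)) // mem_enum.
exact: jJ'.
Qed.

(** The fibres over 1 and 2 correspond to the triples with odd and even [pair_count]. The first kind
    is even in number by [even_odd_triples], and both together exhaust the triples in [I]. *)
Lemma c_fiber_cards (I : {set 'I_28}) : ~~ odd #|I| ->
  ~~ odd #|` fset_set (c_fiber F L I 1)| /\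
  (#|` fset_set (c_fiber F L I 1)| + #|` fset_set (c_fiber F L I 2)|)%N = 'C(#|I|, 3).
Proof.
move=> evI; have [s [s_sym sP]] := bitangent_signs.
have fiberE k (B : pred {set 'I_28}) :
    (forall J : {set 'I_28}, #|J| = 3 ->
      (connected_number F (sum_lines L J) = k) <-> B J) ->
    #|` fset_set (c_fiber F L I k)| =
    #|finset (fun J : {set 'I_28} => [&& J \subset I, #|J| == 3 & B J])|.
  move=> BP; rewrite -(@card_fset_set_image _ _ (fun J => curve F `|` sum_lines L J)).
    rewrite /c_fiber; congr (#|` fset_set [set _ | J in _]|).
    apply/seteqP; split=> J /=; rewrite finset.inE.
      by move=> [-> J3 /(BP J J3) ->]; rewrite J3.
    by move=> /and3P[-> /eqP J3 /(BP J J3)].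
  by move=> J J' _ _; exact: curve_sum_lines_inj.
rewrite (fiberE 1%N (fun J => odd (pair_count s J))); last first.
  by move=> J J3; rewrite sP //; case: odd.
rewrite (fiberE 2 (fun J => ~~ odd (pair_count s J))); last first.
  by move=> J J3; rewrite sP //; case: odd.
split; first exact: even_odd_triples.
rewrite -cards_draws -cardsUI -[RHS]addn0; congr (_ + _)%N.
  by apply: eq_card => J; rewrite !finset.inE -!andb_orr orbN andbT.
by apply/eqP; rewrite cards_eq0; apply/eqP/finset.setP => J; rewrite !finset.inE;
  case: odd; rewrite ?andbF.
Qed.

End Counting.

(** Finiteness is part of the claim because [fset_set] of an infinite set is empty by default, which
    would make the bound void. *)
Theorem corollary2p1 (R : realType) (n : nat)
    (n_even : ~~ odd n) (n_ge4 : (4 <= n)%N) (n_le28 : (n <= 28)%N) :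
  finite_set (possible_pairs R n) /\
  (#|` fset_set (possible_pairs R n)|%:R <= 2^-1 * 'C(n, 3)%:R + 1 :> rat).
Proof.
apply: even_pairs_card => _ [F [L [I [smF bijL In ->]]]] /=.
by rewrite -In; apply: c_fiber_cards => //; rewrite In.
Qed.
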